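(* Let $\mathbb{S}$ and $\mathbb{T}$ be algebraic theories satisfying the following. (S1) For any two $\mathbb{S}$-terms $s_1,s_2$: if $s_1$ contains no variables and $s_1 =_{\mathbb{S}} s_2$, then $s_2$ contains no variables. (S2) For any $\mathbb{S}$-term $s$ and variable $x$: if $s =_{\mathbb{S}} x$, then $\{x\}\vdash s$. (S3) For every $n$-ary operation symbol $\phi_n$ ($n \geq 1$) of $\mathbb{S}$ there is a constant $e_\phi$ of $\mathbb{S}$ which acts as a unit for $\phi_n$: for each $k\le n$, substituting $e_\phi$ for $x_i$ for all $i \neq k$ ($i\le n$) in $\phi_n(x_1,\dots,x_n)$ gives a term provably equal in $\mathbb{S}$ to $x_k$. (S4) $\mathbb{S}$ has a binary term $\mathbf{s}$ and a constant $e_{\mathbf{s}}$ such that (a) $\mathbf{s}(x,e_{\mathbf{s}}) =_{\mathbb{S}} x =_{\mathbb{S}} \mathbf{s}(e_{\mathbf{s}},x)$ and (b) $\mathbf{s}$ is idempotent: $\mathbf{s}(x,x) =_{\mathbb{S}} x$. (T1) For any two $\mathbb{T}$-terms $t_1,t_2$: if $t_1$ contains no variables and $t_1 =_{\mathbb{T}} t_2$, then $t_2$ contains no variables. (T2) For any $\mathbb{T}$-term $t$ and variable $y$: if $t =_{\mathbb{T}} y$, then $\{y\}\vdash t$. (T3), (T4a) $\mathbb{T}$ has a constant $e_{\mathbf{t}}$ and a binary term $\mathbf{t}$ with $\mathbf{t}(y,e_{\mathbf{t}}) =_{\mathbb{T}} y =_{\mathbb{T}} \mathbf{t}(e_{\mathbf{t}},y)$.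 Then there exists no composite theory of $\mathbb{S}$ and $\mathbb{T}$.
   Context: An algebraic theory $\mathbb{T}$ consists of a signature $\Sigma^{\mathbb{T}}$ of finitary operation symbols (each with an arity in $\mathbb{N}$) and a set $E^{\mathbb{T}}$ of pairs of $\Sigma^{\mathbb{T}}$-terms (axioms), over an infinite supply of variables. A constant is a 0-ary term, i.e. a term containing no variables (for instance a 0-ary operation symbol). A binary term is a term in (at most) two variables, and $\mathbf{s}(a,b)$ denotes substitution of $a,b$ for these. $Y \vdash t$ (or $Y\vdash_{\mathbb{T}} t$) means that $t$ is a term (of $\mathbb{T}$) all of whose variables lie in $Y$. $t_1 =_{\mathbb{T}} t_2$ means the terms are provably equal from the axioms in (standard) equational logic. $t[s_i/x_i]$ denotes simultaneous substitution. Composite theory (separating as $\mathbb{T}$-terms of $\mathbb{S}$-terms): a composite of $\mathbb{S}$ and $\mathbb{T}$ is an algebraic theory $\mathbb{U}$ containing both $\mathbb{S}$ and $\mathbb{T}$ (their operations and axioms) such that: 1. Separation: every $\mathbb{U}$-term $u$ satisfies $u =_{\mathbb{U}} t[s_i/x_i]$ for some $\mathbb{T}$-term $t$ and $\mathbb{S}$-terms $s_i$. 2. Essential uniqueness: whenever $X \vdash_{\mathbb{T}} t$, $X' \vdash_{\mathbb{T}} t'$ and $Y_i\vdash_{\mathbb{S}} s_i$ (for $x_i\in X$), $Y'_{i'}\vdash_{\mathbb{S}} s'_{i'}$ (for $x'_{i'}\in X'$) are such that $t[s_i/x_i] =_{\mathbb{U}} t'[s'_{i'}/x'_{i'}]$,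 there are a set of variables $Z$ and functions $f: X \to Z$, $f': X' \to Z$ with: (a) $t[f(x_i)/x_i] =_{\mathbb{T}} t'[f'(x'_{i'})/x'_{i'}]$; (b) $f(x_i)=f(x_j) \Leftrightarrow s_i =_{\mathbb{S}} s_j$; (c) $f'(x'_{i'})=f'(x'_{j'}) \Leftrightarrow s'_{i'} =_{\mathbb{S}} s'_{j'}$; (d) $f(x_i)=f'(x'_{j'}) \Leftrightarrow s_i =_{\mathbb{S}} s'_{j'}$. *)

(* Defs.v *)
From mathcomp Require Import all_boot.

Set Implicit Arguments.
Unset Strict Implicit.
Unset Printing Implicit Defensive.

(* [Sg n] is the type of n-ary operation symbols: indexing by the arity makes
   arity-preserving maps of signatures cast-free. *)
Definition signature := nat -> Type.

(* The infinite supply of variables is [nat]. *)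
Inductive term (Sg : signature) : Type :=
| Var (x : nat)
| App (n : nat) (op : Sg n) (args : 'I_n -> term Sg).

Arguments Var {Sg} x.
Arguments App {Sg n} op args.

Fixpoint occurs (Sg : signature) (x : nat) (t : term Sg) : Prop :=
  match t with
  | Var y => x = y
  | App _ _ args => exists i, occurs x (args i)
  end.

(* Y |- t *)
Definition in_context (Sg : signature) (Y : nat -> Prop) (t : term Sg) : Prop :=
  forall x, occurs x t -> Y x.

Definition constant_term (Sg : signature) (t : term Sg) : Prop :=
  forall x, ~ occurs x t.

Fixpoint subst (Sg : signature) (sigma : nat -> term Sg) (t : term Sg)
    : term Sg :=
  match t with
  | Var x => sigma x
  | App _ op args => App op (fun i => subst sigma (args i))
  end.

(* The (at most) two variables of a binary term are 0 and 1. *)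
Definition binary (Sg : signature) (t : term Sg) : Prop :=
  in_context (fun x => x = 0 \/ x = 1) t.

Definition app2 (Sg : signature) (t a b : term Sg) : term Sg :=
  subst (fun x => if x == 0 then a else b) t.

Record theory : Type := Theory {
  sig : signature;
  ax : term sig -> term sig -> Prop
}.

Inductive eqth (T : theory) : term (sig T) -> term (sig T) -> Prop :=
| eqth_ax l r : ax l r -> eqth l r
| eqth_refl t : eqth t t
| eqth_sym t u : eqth t u -> eqth u t
| eqth_trans t u v : eqth t u -> eqth u v -> eqth t v
| eqth_cong n (op : sig T n) (a b : 'I_n -> term (sig T)) :
    (forall i, eqth (a i) (b i)) -> eqth (App op a) (App op b)
| eqth_subst (sigma : nat -> term (sig T)) t u :
    eqth t u -> eqth (subst sigma t) (subst sigma u).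

Fixpoint map_term (Sg Sg' : signature) (h : forall n, Sg n -> Sg' n)
    (t : term Sg) : term Sg' :=
  match t with
  | Var x => Var x
  | App n op args => App (h n op) (fun i => map_term h (args i))
  end.

(* U contains T: its operation symbols (up to the injections [inc]) and its
   axioms. *)
Record inclusion (T U : theory) : Type := Inclusion {
  inc : forall n, sig T n -> sig U n;
  inc_inj : forall n, injective (@inc n);
  inc_ax : forall l r, ax l r -> ax (map_term inc l) (map_term inc r)
}.

Definition embed (T U : theory) (i : inclusion T U) (t : term (sig T))
    : term (sig U) := map_term (inc i) t.

(* t[s_i/x_i], a T-term of S-terms, as a U-term *)
Definition plug (S T U : theory)
    (iS : inclusion S U) (iT : inclusion T U)
    (t : term (sig T)) (s : nat -> term (sig S)) : term (sig U) :=
  subst (fun x => embed iS (s x)) (embed iT t).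

Definition separation (S T U : theory)
    (iS : inclusion S U) (iT : inclusion T U)
    : Prop :=
  forall u : term (sig U), exists t s, eqth u (plug iS iT t s).

(* Families over, and functions on, a set X of variables are total functions
   on [nat] that are only constrained on X. *)
Definition essential_uniqueness (S T U : theory)
    (iS : inclusion S U) (iT : inclusion T U)
    : Prop :=
  forall (X X' : nat -> Prop) (Y Y' : nat -> nat -> Prop)
         (t t' : term (sig T)) (s s' : nat -> term (sig S)),
  in_context X t -> in_context X' t' ->
  (forall x, X x -> in_context (Y x) (s x)) ->
  (forall x, X' x -> in_context (Y' x) (s' x)) ->
  eqth (plug iS iT t s) (plug iS iT t' s') ->
  exists (Z : nat -> Prop) (f f' : nat -> nat),
    [/\ forall x, X x -> Z (f x)
      & forall x, X' x -> Z (f' x)] /\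
    [/\ eqth (subst (fun x => Var (f x)) t) (subst (fun x => Var (f' x)) t'),
        forall x y, X x -> X y -> (f x = f y <-> eqth (s x) (s y)),
        forall x y, X' x -> X' y -> (f' x = f' y <-> eqth (s' x) (s' y))
      & forall x y, X x -> X' y -> (f x = f' y <-> eqth (s x) (s' y))].

Definition is_composite (S T U : theory) : Prop :=
  exists (iS : inclusion S U) (iT : inclusion T U),
    separation iS iT /\ essential_uniqueness iS iT.

(* e is a unit for op: putting e for every variable but x_k in
   op(x_0, ..., x_(n-1)) gives x_k. *)
Definition acts_as_unit (T : theory) (n : nat) (op : sig T n)
    (e : term (sig T)) : Prop :=
  forall k : 'I_n,
    eqth (subst (fun x => if x == k then Var x else e)
                (App op (fun i : 'I_n => Var i)))
         (Var k).

(* Main.v *)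
Require Import Defs.
From mathcomp Require Import all_boot.
From Stdlib Require Import FunctionalExtensionality.

Set Implicit Arguments.
Unset Strict Implicit.
Unset Printing Implicit Defensive.

(** Suppose a composite U exists.  Every operation of S has a unit, so e_t is a
    zero for it in U: separating phi(x_1, .., e_t, .., x_n) and putting the unit
    of phi for the variables gives e_t, which by essential uniqueness and (T1)
    forces the separated T-term to be e_t already.  Hence any S-term collapses to
    e_t as soon as e_t is put for a variable occurring in it.

    Now separate s(t(y_0, y_1), t(y_2, y_3)) as t'[s_i/x_i].
    Identifying y_2 with y_0 and y_3 with y_1 gives t(y_0, y_1) by idempotence;
    putting e_t for both variables, (T1) and (S2) show that each s_i has its
    variables in {y_0, y_2} or in {y_1, y_3}.
    Putting e_t for y_0 and y_3 instead gives s(y_1, y_2), and every s_i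
    containing y_0 or y_3 collapses; by (T1) and (T2) some other s_i must equal
    s(y_1, y_2).  But that s_i lacks y_1 or y_2, which contradicts the unit law
    of s. *)

(** * Substitution, occurrence of variables and embeddings of terms *)

Lemma subst_ext (Sg : signature) (sigma tau : nat -> term Sg) (t : term Sg) :
  (forall x, occurs x t -> sigma x = tau x) -> subst sigma t = subst tau t.
Proof.
elim: t => [x|n op a IH] /= eq_st; first exact: eq_st.
congr App; apply: functional_extensionality => i.
by apply: IH => x xa; apply: eq_st; exists i.
Qed.

Lemma subst_Var (Sg : signature) (t : term Sg) : subst Var t = t.
Proof.
elim: t => [//|n op a IH] /=.
by congr App; apply: functional_extensionality => i; apply: IH.
Qed.

Lemma subst_constant (Sg : signature) (sigma : nat -> term Sg) (t : term Sg) :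
  constant_term t -> subst sigma t = t.
Proof.
by move=> ct; rewrite -[RHS]subst_Var; apply: subst_ext => x /ct.
Qed.

Lemma subst_subst (Sg : signature) (sigma tau : nat -> term Sg) (t : term Sg) :
  subst sigma (subst tau t) = subst (fun x => subst sigma (tau x)) t.
Proof.
elim: t => [//|n op a IH] /=.
by congr App; apply: functional_extensionality => i; apply: IH.
Qed.

Lemma occurs_subst (Sg : signature) (sigma : nat -> term Sg) (t : term Sg) y :
  occurs y (subst sigma t) <-> exists2 x, occurs x t & occurs y (sigma x).
Proof.
elim: t => [x|n op a IH] /=; first by split=> [|[_ ->]]; first by exists x.
split=> [[i /IH[x xi yx]]|[x [i xi] yx]]; first by exists x => //; exists i.
by exists i; apply/IH; exists x.
Qed.

Lemma subst_app2 (Sg : signature) (sigma : nat -> term Sg) (t a b : term Sg) :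
  subst sigma (app2 t a b) = app2 t (subst sigma a) (subst sigma b).
Proof.
rewrite /app2 subst_subst; apply: subst_ext => x _.
by case: eqP.
Qed.

(** A decidable form of [occurs], so that a substitution can be defined by cases on it. *)
Fixpoint occursb (Sg : signature) (x : nat) (t : term Sg) : bool :=
  match t with
  | Var y => x == y
  | App _ _ args => [exists i, occursb x (args i)]
  end.

Lemma occursP (Sg : signature) x (t : term Sg) : reflect (occurs x t) (occursb x t).
Proof.
elim: t => [y|n op a IH] /=; first exact: eqP.
by apply: (iffP existsP) => -[i xi]; exists i; apply/IH.
Qed.

Lemma eqth_subst_ext (T : theory) (sigma tau : nat -> term (sig T)) t :
  (forall x, occurs x t -> eqth (sigma x) (tau x)) ->
  eqth (subst sigma t) (subst tau t).
Proof.
elim: t => [x|n op a IH] /= eq_st; first exact: eq_st.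
by apply: eqth_cong => i; apply: IH => x xa; apply: eq_st; exists i.
Qed.

Lemma eqth_app2 (T : theory) (t a b c d : term (sig T)) :
  eqth a c -> eqth b d -> eqth (app2 t a b) (app2 t c d).
Proof.
by move=> ac bd; apply: eqth_subst_ext => x _; case: eqP.
Qed.

Section Embed.
Variables (T U : theory) (i : inclusion T U).

Lemma embed_subst (sigma : nat -> term (sig T)) t :
  embed i (subst sigma t) = subst (fun x => embed i (sigma x)) (embed i t).
Proof.
rewrite /embed; elim: t => [//|n op a IH] /=.
by congr App; apply: functional_extensionality => j; apply: IH.
Qed.

Lemma occurs_embed x t : occurs x (embed i t) <-> occurs x t.
Proof.
rewrite /embed; elim: t => [//|n op a IH] /=.
by split=> -[j /IH xj]; exists j.
Qed.

Lemma constant_embed t : constant_term t -> constant_term (embed i t).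
Proof. by move=> ct x /occurs_embed /ct. Qed.

Lemma embed_app2 t a b :
  embed i (app2 t a b) = app2 (embed i t) (embed i a) (embed i b).
Proof.
by rewrite /app2 embed_subst; apply: subst_ext => x _; case: eqP.
Qed.

Lemma embed_eqth t u : eqth t u -> eqth (embed i t) (embed i u).
Proof.
elim=> {t u} [l r lr|t|t u _|t u v _ tu _ uv|n op a b _ IH|sigma t u _ IH].
- by apply: eqth_ax; apply: inc_ax.
- exact: eqth_refl.
- exact: eqth_sym.
- exact: eqth_trans uv.
- exact: eqth_cong.
- by rewrite !embed_subst; apply: eqth_subst.
Qed.

End Embed.

(** * Consequences of separation and essential uniqueness *)

Section Composite.
Variables (S T U : theory) (iS : inclusion S U) (iT : inclusion T U).
Hypotheses (sepU : separation iS iT) (uniqU : essential_uniqueness iS iT).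
Hypothesis T1 : forall t1 t2 : term (sig T),
  constant_term t1 -> eqth t1 t2 -> constant_term t2.

Lemma subst_plug sigma (t : term (sig T)) (s : nat -> term (sig S)) :
  subst (fun x => embed iS (sigma x)) (plug iS iT t s)
    = plug iS iT t (fun x => subst sigma (s x)).
Proof.
rewrite /plug subst_subst; apply: subst_ext => x _.
by rewrite embed_subst.
Qed.

(** The part of essential uniqueness that the proof uses. [X] may exceed the variables of [t], so
    that for a binary [t] both [f 0] and [f 1] are controlled even if one of the two variables does
    not occur; [X'] is exactly the set of variables of [t']. *)
Lemma eqth_plug_inv (X : nat -> Prop) (t t' : term (sig T))
    (s s' : nat -> term (sig S)) :
  in_context X t -> eqth (plug iS iT t s) (plug iS iT t' s') ->
  exists f f' : nat -> nat,
    eqth (subst (fun x => Var (f x)) t) (subst (fun x => Var (f' x)) t') /\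
    forall x y, X x -> occurs y t' -> f x = f' y -> eqth (s x) (s' y).
Proof.
move=> Xt eq_tt'.
have [Z [f [f' [_ [eqf _ _ ff']]]]] :=
  @uniqU X (fun x => occurs x t')
    (fun x y => occurs y (s x)) (fun x y => occurs y (s' x)) t t' s s'
    Xt (fun _ => id) (fun _ _ _ => id) (fun _ _ _ => id) eq_tt'.
by exists f, f'; split=> // x y Xx yt'; move/ff'; apply.
Qed.

(** Uniqueness equates [e] with a renaming of [t]; by [T1] that renaming has no variables, so [t]
    has none and the renaming does nothing. *)
Lemma plug_eqth_constant (e t : term (sig T)) (s : nat -> term (sig S)) :
  constant_term e -> eqth (embed iT e) (plug iS iT t s) ->
  constant_term t /\ eqth e t.
Proof.
move=> ce; have -> : embed iT e = plug iS iT e s.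
  by rewrite /plug subst_constant //; apply: constant_embed.
case/(eqth_plug_inv (fun _ => id)) => f [f' []].
rewrite (subst_constant _ ce) => et _.
have ct : constant_term t.
  move=> x xt; case: (T1 ce et (x := f' x)).
  by apply/occurs_subst; exists x.
by move: et; rewrite subst_constant.
Qed.

Variable e : term (sig T).
Hypothesis ce : constant_term e.

Lemma operation_zero n (phi : sig S n) (k : 'I_n) (c : term (sig S))
    (a : 'I_n -> term (sig U)) :
  constant_term c -> acts_as_unit phi c -> eqth (a k) (embed iT e) ->
  eqth (App (inc iS phi) a) (embed iT e).
Proof.
move=> cc unit_c ak.
have ceU := constant_embed (i := iT) ce.
(* The generic instance: distinct variables off position [k]. The arguments [a] are put in only at
   the end, by [sigma]. *)
pose u := App (inc iS phi) (fun j => if j == k then embed iT e else Var j).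
have [t [s ts]] := sepU u.
have [ct et] : constant_term t /\ eqth e t.
  (* Putting [c] for every variable changes only the S-terms of the separated form, while [u]
     becomes the left side of the unit law of [phi] taken at [e]. *)
  apply: (@plug_eqth_constant _ _ (fun x => subst (fun=> c) (s x)) ce).
  rewrite -subst_plug; apply: eqth_trans (eqth_subst _ ts).
  have /= := eqth_subst (fun=> embed iT e) (embed_eqth iS (unit_c k)).
  move/eqth_sym/eqth_trans; apply; apply: eqth_cong => j.
  rewrite -val_eqE /=; case: ifP => _ /=.
    by rewrite subst_constant //; apply: eqth_refl.
  rewrite subst_constant; first exact: eqth_refl.
  exact: constant_embed.
have ue : eqth u (embed iT e).
  apply: eqth_trans ts _; rewrite /plug subst_constant; last exact: constant_embed.
  exact/eqth_sym/embed_eqth.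
(* Variables below [n] are read as argument positions; the default [Var x] is never reached. *)
pose sigma x := if insub x is Some j then a j else Var x.
have := eqth_subst sigma ue; rewrite [subst _ (embed _ _)]subst_constant //.
apply: eqth_trans; rewrite /u /=; apply: eqth_cong => j.
case: eqP => [->|_] /=.
  by rewrite subst_constant.
by rewrite /sigma valK; apply: eqth_refl.
Qed.

Hypothesis S3 : forall (n : nat) (phi : sig S n), 1 <= n ->
  exists c : term (sig S), constant_term c /\ acts_as_unit phi c.

(** The zero climbs from an occurrence of [x] to the root: each operation on the way has an argument
    containing [x], hence positive arity and a unit. *)
Lemma subst_zero x (s : term (sig S)) (sigma : nat -> term (sig U)) :
  occurs x s -> sigma x = embed iT e ->
  eqth (subst sigma (embed iS s)) (embed iT e).
Proof.
move=> xs sx; elim: s xs => [y <-|n phi a IH [k xk]] /=.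
  by rewrite sx; apply: eqth_refl.
have [|c [cc unit_c]] := S3 phi; first exact: leq_ltn_trans (ltn_ord k).
exact: (operation_zero (k := k) cc unit_c (IH k xk)).
Qed.

End Composite.

Theorem theorem4p24 (S T : theory)
  (S1 : forall s1 s2 : term (sig S), constant_term s1 -> eqth s1 s2 -> constant_term s2)
  (S2 : forall (s : term (sig S)) (x : nat),
      eqth s (Var x) -> in_context (fun y => y = x) s)
  (S3 : forall (n : nat) (phi : sig S n), 1 <= n ->
      exists e : term (sig S), constant_term e /\ acts_as_unit phi e)
  (S4 : exists s e : term (sig S),
      [/\ binary s,
          constant_term e,
          forall x : nat, eqth (app2 s (Var x) e) (Var x) /\
                          eqth (Var x) (app2 s e (Var x))
        & forall x : nat, eqth (app2 s (Var x) (Var x)) (Var x)])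
  (T1 : forall t1 t2 : term (sig T), constant_term t1 -> eqth t1 t2 -> constant_term t2)
  (T2 : forall (t : term (sig T)) (y : nat),
      eqth t (Var y) -> in_context (fun z => z = y) t)
  (T34 : exists e t : term (sig T),
      [/\ constant_term e,
          binary t
        & forall y : nat, eqth (app2 t (Var y) e) (Var y) /\
                          eqth (Var y) (app2 t e (Var y))]) :
  ~ exists U : theory, is_composite S T U.
Proof.
case=> U [iS [iT [sepU uniqU]]].
case: S4 => s [es [bs ces units idem]]; case: T34 => et [t [cet bt unitt]].
have s_unitr a : eqth (app2 s a es) a.
  have := eqth_subst (fun=> a) (units 0).1.
  by rewrite subst_app2 (subst_constant _ ces).
have s_unitl a : eqth (app2 s es a) a.
  have := eqth_subst (fun=> a) (eqth_sym (units 0).2).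
  by rewrite subst_app2 (subst_constant _ ces).
have t_unitr a : eqth (app2 t a et) a.
  have := eqth_subst (fun=> a) (unitt 0).1.
  by rewrite subst_app2 (subst_constant _ cet).
have t_unitl a : eqth (app2 t et a) a.
  have := eqth_subst (fun=> a) (eqth_sym (unitt 0).2).
  by rewrite subst_app2 (subst_constant _ cet).
have cetU := constant_embed (i := iT) cet.
pose y01 := app2 t (Var 0) (Var 1); pose y23 := app2 t (Var 2) (Var 3).
have [t' [s' ts']] := sepU (app2 (embed iS s) (embed iT y01) (embed iT y23)).
have s'_split i : occurs i t' ->
    in_context (fun y => y = 0 \/ y = 2) (s' i) \/
    in_context (fun y => y = 1 \/ y = 3) (s' i).
  pose r x := if x == 2 then 0 else if x == 3 then 1 else x.
  have : eqth (plug iS iT t Var)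
              (plug iS iT t' (fun x => subst (fun y => Var (r y)) (s' x))).
    rewrite -subst_plug; apply: eqth_trans (eqth_subst _ ts').
    have -> : plug iS iT t Var = embed iT t by apply: subst_Var.
    rewrite subst_app2 !embed_app2 !subst_app2 /=.
    have -> : app2 (embed iT t) (Var 0) (Var 1) = embed iT t.
      rewrite -[RHS]subst_Var; apply: subst_ext => x /occurs_embed/bt.
      by case=> ->.
    have := eqth_subst (fun=> embed iT t) (embed_eqth iS (idem 0)).
    by rewrite embed_app2 subst_app2; apply: eqth_sym.
  case/(eqth_plug_inv uniqU bt) => f [f' [tt' ff']] it'.
  have r_ctx x : x = 0 \/ x = 1 -> f x = f' i ->
      in_context (fun y => r y = x) (s' i).
    move=> x01 /(ff' _ _ x01 it')/eqth_sym/S2 ctx y ys'.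
    by apply: ctx; apply/occurs_subst; exists y.
  case: (eqVneq (f 0) (f' i)) => [/(r_ctx 0 (or_introl erefl)) ctx|f0].
    left=> y /ctx; rewrite /r; case: eqP => [-> _|_]; first by right.
    by case: eqP => // _ ->; left.
  case: (eqVneq (f 1) (f' i)) => [/(r_ctx 1 (or_intror erefl)) ctx|f1].
    right=> y /ctx; rewrite /r; case: eqP => // _.
    case: eqP => [-> _|_]; first by right.
    by move=> ->; left.
  (* If [f' i] is neither [f 0] nor [f 1], then [g] turns the left side into t(e_t, e_t), that is
     e_t, but leaves the variable [f' i] on the right, against [T1]. *)
  pose g x := if (x == f 0) || (x == f 1) then et else Var x.
  have et_t' : eqth et (subst (fun x => g (f' x)) t').
    have := eqth_subst g tt'; rewrite !subst_subst; apply: eqth_trans.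
    apply: eqth_trans (eqth_sym (t_unitl et)) _.
    apply: eqth_subst_ext => x /bt[] -> /=; rewrite /g eqxx ?orbT;
      exact: eqth_refl.
  have /(_ (f' i)) := T1 _ _ cet et_t'; case; apply/occurs_subst; exists i => //.
  by rewrite /g eq_sym (negPf f0) eq_sym (negPf f1).
(* The indices whose S-term collapses when e_t is put for y_0 and y_3; [t''] is what remains of
   [t']. *)
pose hit x := occursb 0 (s' x) || occursb 3 (s' x).
pose t'' := subst (fun x => if hit x then et else Var x) t'.
have : eqth (plug iS iT (Var 0) (fun=> app2 s (Var 1) (Var 2)))
            (plug iS iT t'' s').
  pose tau x : term (sig U) := if (x == 0) || (x == 3) then embed iT et else Var x.
  apply: (eqth_trans (u := subst tau (plug iS iT t' s'))).
    apply: eqth_trans (eqth_subst tau ts').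
    rewrite subst_app2 !embed_app2 !subst_app2 /plug /= -/(embed iS _) embed_app2.
    apply: eqth_app2; apply: eqth_sym.
      by have := embed_eqth iT (t_unitl (Var 1)); rewrite embed_app2.
    by have := embed_eqth iT (t_unitr (Var 2)); rewrite embed_app2.
  rewrite /t'' /plug embed_subst !subst_subst.
  apply: eqth_subst_ext => x _; rewrite /hit.
  case: occursP => [x0|n0].
    rewrite /= (subst_constant _ cetU).
    exact: (subst_zero sepU uniqU T1 cet S3 x0).
  case: occursP => [x3|n3] /=.
    rewrite (subst_constant _ cetU).
    exact: (subst_zero sepU uniqU T1 cet S3 x3).
  rewrite -[X in eqth _ X]subst_Var.
  apply: eqth_subst_ext => y /occurs_embed ys'; rewrite /tau.
  case: eqP => [y0|_]; first by rewrite y0 in ys'.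
  by case: eqP => [y3|_]; [rewrite y3 in ys'|apply: eqth_refl].
case/(eqth_plug_inv uniqU (X := fun x => x = 0)) => [x -> //|f [f' [tt'' ff']]].
(* By [T2] a variable here can only be [f 0], which makes some surviving [s' i] equal to s(y_1,
   y_2). With no variables left, [T1] would make [Var (f 0)] a constant. *)
have ct'' : constant_term (subst (fun x => Var (f' x)) t'').
  move=> x xt''; have fx := T2 _ _ (eqth_sym tt'') _ xt''.
  have [i it'' /= xi] := (occurs_subst _ _ _).1 xt''.
  have eq_s'i := ff' 0 i erefl it'' (etrans (esym fx) xi).
  have [it' hiti] : occurs i t' /\ ~~ hit i.
    have [j jt'] := (occurs_subst _ _ _).1 it''.
    by case: ifPn => [_ /cet|hj /= ->].
  have [n0 n3] : ~ occurs 0 (s' i) /\ ~ occurs 3 (s' i).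
    by move: hiti; rewrite negb_or => /andP[/occursP ? /occursP ?].
  (* If y_z were the only variable of [s' i], putting [es] for it would leave a constant on one side
     and, by the unit law, the other of y_1, y_2 on the other side, against [S1]. *)
  pose g z y : term (sig S) := if y == z then es else Var y.
  have not_sub1 z : z \in [:: 1; 2] -> ~ in_context (fun y => y = z) (s' i).
    move=> z12 ctx.
    have cg : constant_term (subst (g z) (s' i)).
      by move=> y /occurs_subst[w /ctx ->]; rewrite /g eqxx => /ces.
    have := S1 _ _ cg (eqth_sym (eqth_subst (g z) eq_s'i)).
    rewrite subst_app2 /g /=.
    move: z12; rewrite !inE => /orP[]/eqP -> /= c.
      by have /(_ 2) := S1 _ _ c (s_unitl _); apply.
    by have /(_ 1) := S1 _ _ c (s_unitr _); apply.
  case: (s'_split i it') => ctx.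
    by apply: (not_sub1 2 isT) => y yi; case: (ctx y yi) => // y0; rewrite y0 in yi.
  by apply: (not_sub1 1 isT) => y yi; case: (ctx y yi) => // y3; rewrite y3 in yi.
by have /(_ (f 0)) := T1 _ _ ct'' (eqth_sym tt''); apply.
Qed.
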